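(* Let $T$ be a finite abelian group and let $\psi\colon T\to\mathbb{R}/\mathbb{Z}$ be $2$-linear. Let $G(\psi)=\sum_{t\in T}e^{2\pi i\psi(t)}$. If $\psi$ is not tame then $|G(\psi)|=0$. If $\psi$ is tame then $|G(\psi)|=\sqrt{|T^\perp|\cdot|T|}$.
   Context: A function $\psi\colon T\to\mathbb{R}/\mathbb{Z}$ on a finite abelian group is $2$-linear if $b(x,y)=\psi(x+y)-\psi(x)-\psi(y)$ is bilinear. $T^\perp=\{t\in T: b(t,s)=0\ \forall s\in T\}$. The restriction of $\psi$ to $T^\perp$ is a homomorphism; $\psi$ is called tame if this restriction is trivial. *)

(* Defs.v *)
From HB Require Import structures.
From mathcomp Require Import all_boot all_order all_algebra complex.
From mathcomp Require Import reals sequences exp trigo.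

Set Implicit Arguments.
Unset Strict Implicit.
Unset Printing Implicit Defensive.

Import Order.TTheory GRing.Theory Num.Theory.
Local Open Scope ring_scope.
Local Open Scope quotient_scope.
Local Open Scope complex_scope.

(* [Num.int_num_subdef] is the predicate underlying [x \is a Num.int]. *)
Definition int_subgroup (R : realType) : zmodClosed R :=
  GRing.ZmodClosed.clone R Num.int_num_subdef _.

Definition RmodZ (R : realType) := {ideal_quot (int_subgroup R)}.

HB.instance Definition _ (R : realType) := GRing.Zmodule.on (RmodZ R).
HB.instance Definition _ (R : realType) :=
  EqQuotient.on (RmodZ R).

Lemma RmodZ_eqP (R : realType) (x y : R) :
  (\pi_(RmodZ R) x = \pi_(RmodZ R) y) <-> (x - y \is a Num.int).
Proof.
rewrite -[x - y \is a Num.int]/(x - y \in @Num.int_num_subdef R).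
by rewrite Quotient.idealrBE; split=> [->|/eqP].
Qed.

Lemma RmodZ_piD (R : realType) (x y : R) :
  \pi_(RmodZ R) (x + y) = \pi_(RmodZ R) x + \pi_(RmodZ R) y.
Proof. by rewrite (Quotient.pi_add (int_subgroup R)). Qed.

Definition cexp (R : realType) (z : R[i]) : R[i] :=
  let: a +i* b := z in (expR a)%:C * (cos b +i* sin b).

(* e^(2 pi i u) for u in R/Z; by [e2piE] it does not depend on the
   representative. *)
Definition e2pi (R : realType) (u : RmodZ R) : R[i] :=
  cexp (2 * (pi : R)%:C * 'i * (repr u)%:C).

Lemma e2piE (R : realType) (x : R) :
  e2pi (\pi_(RmodZ R) x) = cexp (2 * (pi : R)%:C * 'i * x%:C).
Proof.
have E y : cexp (2 * (pi : R)%:C * 'i * y%:C) =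
    cos (y * (pi *+ 2)) +i* sin (y * (pi *+ 2)).
  rewrite /cexp.
  have -> : (2 * (pi : R)%:C * 'i * y%:C) = 0 +i* (y * (pi *+ 2)).
    rewrite -[2]/(1 + 1); simpc; congr (_ +i* _).
    by rewrite mulr2n mulrC mulrDl mul1r.
  by rewrite /= expR0 mul1r.
rewrite /e2pi !E; set y := repr _.
have /RmodZ_eqP/intrP[m] : \pi_(RmodZ R) y = \pi_(RmodZ R) x by rewrite reprK.
move=> /eqP; rewrite subr_eq addrC => /eqP ->.
have per (f : R -> R) n : periodic f (pi *+ 2) ->
    f ((x + n%:~R) * (pi *+ 2)) = f (x * (pi *+ 2)).
  move=> fP; rewrite mulrDl; case: n => n.
    by rewrite -pmulrn mulr_natl periodicn.
  rewrite NegzE mulrNz mulNr -pmulrn mulr_natl.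
  by rewrite -[LHS](periodicn fP n.+1) subrK.
by rewrite !per //; [exact: sinD2pi | exact: cosD2pi].
Qed.

Section QuadraticGaussSum.
Variables (R : realType) (T : finZmodType) (psi : T -> RmodZ R).

Definition bform (x y : T) : RmodZ R := psi (x + y) - psi x - psi y.

Definition two_linear : Prop :=
  (forall y, {morph bform^~ y : x1 x2 / x1 + x2})
  /\ (forall x, {morph bform x : y1 y2 / y1 + y2}).

Definition perp : {set T} := [set t | [forall s, bform t s == 0]].

Definition tame : Prop := {in perp, forall t, psi t = 0}.

Definition gauss_sum : R[i] := \sum_(t : T) e2pi (psi t).

End QuadraticGaussSum.

(* Main.v *)
(** Expanding [|G|^2] as a double sum over [(t, t + h)] gives
    [\sum_h e(psi h) \sum_t e(b(t, h))]. The inner sum is a character sum: it is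
    [|T|] when [h] lies in [T^perp] and [0] otherwise. What remains is [|T|]
    times the sum over [T^perp] of the character [e(psi)], which is [|T^perp|]
    if [psi] vanishes there and [0] otherwise. *)
Require Import Defs.
From HB Require Import structures.
From mathcomp Require Import all_boot all_order all_algebra complex.
From mathcomp Require Import reals.
From mathcomp Require Import exp trigo.
Import Order.TTheory GRing.Theory Num.Theory.
Local Open Scope ring_scope.
Local Open Scope complex_scope.

Section CircleCharacter.
Variable R : realType.
Implicit Types (x : R) (u v : RmodZ R).

Lemma e2pi_cos_sin x :
  e2pi (\pi_(RmodZ R)%qT x) = cos (x * (pi *+ 2)) +i* sin (x * (pi *+ 2)).
Proof.
rewrite e2piE /cexp.
have -> : 2 * (pi : R)%:C * 'i * x%:C = 0 +i* (x * (pi *+ 2)).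
  rewrite -[2]/(1 + 1); simpc; congr (_ +i* _).
  by rewrite mulr2n mulrC mulrDl mul1r.
by rewrite /= expR0 mul1r.
Qed.

Lemma e2piD u v : e2pi (u + v) = e2pi u * e2pi v.
Proof.
rewrite -[u]reprK -[v]reprK -RmodZ_piD !e2pi_cos_sin mulrDl cosD sinD.
by simpc; congr (_ +i* _); rewrite addrC [X in _ + X]mulrC // mulrC.
Qed.

Lemma RmodZ_pi0 : \pi_(RmodZ R)%qT 0 = 0.
Proof. by apply: (addrI (\pi_(RmodZ R)%qT 0)); rewrite -RmodZ_piD !addr0. Qed.

Lemma e2pi0 : e2pi (0 : RmodZ R) = 1.
Proof. by rewrite -RmodZ_pi0 e2pi_cos_sin mul0r cos0 sin0. Qed.

(** Both sides are inverses of [e2pi u]: the right one by additivity, the left one because cos^2 +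
    sin^2 = 1. *)
Lemma conjc_e2pi u : (e2pi u)^*%R = e2pi (- u).
Proof.
have e2piV : e2pi u * e2pi (- u) = 1 by rewrite -e2piD subrr e2pi0.
have e2piJ : e2pi u * (e2pi u)^*%R = 1.
  rewrite -[u]reprK e2pi_cos_sin; set a := repr u * _.
  rewrite /Num.conj /=; simpc.
  by rewrite -!expr2 cos2Dsin2 mulrC addNr.
have e2pi_neq0 : e2pi u != 0.
  by apply/eqP => u0; move/eqP: e2piV; rewrite u0 mul0r eq_sym oner_eq0.
by apply: (mulfI e2pi_neq0); rewrite e2piJ e2piV.
Qed.

(** Take the representative [f] of [u] in [0, 1). By the double-angle formula, cos(2 pi f) = 1
    forces sin(pi f) = 0, whereas sin is positive on the open interval (0, pi); hence [f = 0]. *)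
Lemma e2pi_eq1 u : e2pi u = 1 -> u = 0.
Proof.
rewrite -[u]reprK; set y := repr u.
have -> : \pi_(RmodZ R)%qT y = \pi_(RmodZ R)%qT (y - (Num.floor y)%:~R).
  by apply/RmodZ_eqP; rewrite opprB addrC subrK intr_int.
set f := y - _.
have f_ge0 : 0 <= f by rewrite subr_ge0 floor_le.
have f_lt1 : f < 1 by rewrite ltrBlDl -[1]/(1%:~R) -intrD floorD1_gt.
rewrite e2pi_cos_sin mulrnAr => /eqP; rewrite eq_complex => /andP[/= /eqP + _].
rewrite cos_mulr2n => cos1.
have : sin (f * pi) ^+ 2 *+ 2 == 0.
  by rewrite sin2cos2 mulrnBl -[_ *+ 2 in X in _ - X](subrK 1) cos1 mulr2n subrr.
rewrite mulrn_eq0 /= sqrf_eq0.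
have [-> _|f_neq0 /eqP sin0] := eqVneq f 0; first exact: RmodZ_pi0.
have f_gt0 : 0 < f by rewrite lt_def f_neq0.
suff : 0 < sin (f * pi) by rewrite sin0 ltxx.
by rewrite sin_gt0_pi // mulr_gt0 ?pi_gt0 //= gtr_pMl ?pi_gt0.
Qed.

(** Translation by [a] permutes [A] and multiplies the sum by [e2pi (f a)], which differs from 1.
    This serves both for [b(-, h)] on all of [T] and for [psi] on [perp psi]. *)
Lemma sum_e2pi_eq0 (T : finZmodType) (A : {set T}) (f : T -> RmodZ R) (a : T) :
    (forall t, (t + a \in A) = (t \in A)) ->
    {in A, forall t, f (t + a) = f t + f a} -> f a <> 0 ->
  \sum_(t in A) e2pi (f t) = 0.
Proof.
move=> Aa fD fa; set S := \sum_(t in A) _.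
have : S = S * e2pi (f a).
  rewrite {1}/S (reindex_inj (addIr a)) /= mulr_suml.
  by apply: eq_big => [t|t]; rewrite Aa // => /fD ->; rewrite e2piD.
move/eqP; rewrite -subr_eq0 -[X in X - _]mulr1 -mulrBr mulf_eq0 subr_eq0.
by case/orP => /eqP // /esym /e2pi_eq1.
Qed.

End CircleCharacter.

Section TwoLinear.
Variables (R : realType) (T : finZmodType) (psi : T -> RmodZ R).
Hypothesis psi2 : two_linear psi.
Local Notation b := (bform psi).

Lemma psiD x y : psi (x + y) = psi x + psi y + b x y.
Proof. by rewrite /bform -[psi (x + y) - _ - _]addrA -opprD [RHS]addrC subrK. Qed.

Lemma bform_perp t s : t \in perp psi -> b t s = 0.
Proof. by rewrite inE => /forallP/(_ s)/eqP. Qed.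

Lemma bformC x y : b x y = b y x.
Proof. by rewrite /bform [x + y]addrC addrAC. Qed.

Lemma perp_addr a t : a \in perp psi -> (t + a \in perp psi) = (t \in perp psi).
Proof.
move=> aP; rewrite !inE; apply: eq_forallb => s.
by rewrite psi2.1 (bform_perp a s aP) addr0.
Qed.

Lemma sum_e2pi_bform h :
  \sum_(t : T) e2pi (b t h) = (if h \in perp psi then #|T| else 0)%:R.
Proof.
case: ifPn => [hP|].
  under eq_bigr => t _ do rewrite bformC bform_perp // e2pi0.
  by rewrite sumr_const.
(* The witness [s] that [h] is outside [perp psi] is the translation along which the character
   [b(-, h)] is nontrivial. *)
rewrite inE negb_forall => /existsP[s /eqP bhs].
rewrite (eq_bigl [in [set: T]]) => [|t]; last by rewrite inE.
rewrite (@sum_e2pi_eq0 R T setT (b^~ h) s) // => [t|t _|].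
- by rewrite !inE.
- exact: psi2.1.
- by rewrite bformC.
Qed.

Lemma sqr_norm_gauss_sum :
  `|gauss_sum psi| ^+ 2 = #|T|%:R * \sum_(h in perp psi) e2pi (psi h).
Proof.
rewrite normCK /gauss_sum rmorph_sum /= mulrC mulr_suml.
(* Substitute [s = t + h]: the conjugate factor cancels [psi t] in
   [psi (t + h) = psi t + psi h + b t h]. *)
have shift t : (e2pi (psi t))^*%R * \sum_(s : T) e2pi (psi s) =
    \sum_(h : T) e2pi (psi h) * e2pi (b t h).
  rewrite (reindex_inj (addrI t)) mulr_sumr /=; apply: eq_bigr => h _.
  by rewrite conjc_e2pi -!e2piD psiD -addrA addKr.
rewrite (eq_bigr _ (fun t _ => shift t)).
rewrite exchange_big mulr_sumr [RHS]big_mkcond; apply: eq_bigr => h _ /=.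
rewrite -mulr_sumr sum_e2pi_bform.
by case: ifP => _; rewrite ?mulr0 // mulrC.
Qed.

End TwoLinear.

Theorem theorem1p13 (R : realType) (T : finZmodType) (psi : T -> RmodZ R)
    (psi2 : two_linear psi) :
  (~ tame psi -> `|gauss_sum psi| = 0)
  /\ (tame psi ->
      `|gauss_sum psi| = (Num.sqrt ((#|perp psi| * #|T|)%N%:R : R))%:C).
Proof.
split=> [not_tame|psi_tame].
  have /forall_inPn[a aP /eqP psia] : ~~ [forall t in perp psi, psi t == 0].
    by apply/negP => /forall_inP psi0; apply: not_tame => t /psi0/eqP.
  apply/eqP; rewrite -sqrf_eq0 sqr_norm_gauss_sum //.
  rewrite (@sum_e2pi_eq0 R T (perp psi) psi a) ?mulr0 // => t.
    exact: perp_addr.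
  (* On [perp psi] the [b] term vanishes, so [psi] is additive there. *)
  by move=> tP; rewrite psiD bform_perp // addr0.
(* Both sides are nonnegative, so it suffices to compare squares. *)
apply/eqP; rewrite -(@eqrXn2 _ 2) ?normr_ge0 ?lecR ?sqrtr_ge0 //.
rewrite sqr_norm_gauss_sum // -rmorphXn /= sqr_sqrtr ?ler0n //.
rewrite (eq_bigr (fun _ => 1)) => [|h hP]; last by rewrite psi_tame ?e2pi0.
by rewrite sumr_const -natrM mulnC rmorph_nat.
Qed.
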